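(* Let $P$ be a finite Eulerian Sheffer poset of rank $n\geq 3$ with $B(3)=D(3)=6$. If $n$ is odd, then there is an integer $k\geq 1$ such that $P\cong\boxplus^k(B_n)$. If $n$ is even, then $P\cong B_n$.
   Context: A finite graded poset with minimum $\hat 0$ and maximum $\hat 1$ is Eulerian if every interval $[x,y]$ with $x<y$ has as many elements of even rank as of odd rank. A finite Sheffer poset is a finite poset with $\hat 0$ and $\hat 1$ in which every interval is graded, any two intervals $[\hat 0,y]$ of the same length $n$ have the same number $D(n)$ of maximal chains (Sheffer factorial function), and any two intervals $[x,y]$ of the same length $n$ with $x\neq\hat 0$ have the same number $B(n)$ of maximal chains (binomial factorial function). $B_n$ is the boolean lattice of subsets of $\{1,\dots,n\}$ ordered by inclusion. For a poset $Q$ with unique minimum and maximum, $\boxplus^k(Q)$ is obtained from $k$ disjoint copies of $Q$ by identifying all minimum elements into one and all maximum elements into one. *)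

(* Defs.v *)
From HB Require Import structures.
From mathcomp Require Import all_boot all_order.
Set Implicit Arguments.
Unset Strict Implicit.
Unset Printing Implicit Defensive.
Import Order.TTheory Order.SetSubsetOrder.Exports.
Local Open Scope order_scope.

Section Posets.
Context {d : Order.disp_t} {P : finTBPOrderType d}.
Implicit Types (x y : P) (C : {set P}).

Definition interval x y : {set P} := [set z | x <= z <= y].

Definition is_chain C : bool := [forall a in C, forall b in C, a >=< b].

Definition maximal_chains x y : {set {set P}} :=
  [set C | maxset (fun C' => is_chain C' && (C' \subset interval x y)) C].

(* A chain with m + 1 elements has length m; the length of an interval is the
   length of its longest chains, i.e. of any of its maximal chains when the
   interval is graded. *)
Definition interval_length x y : nat :=
  (\max_(C in maximal_chains x y) #|C|.-1)%N.

Definition graded_interval x y : Prop :=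
  forall C1 C2, C1 \in maximal_chains x y -> C2 \in maximal_chains x y ->
  #|C1| = #|C2|.

Definition rank x : nat := interval_length \bot x.

End Posets.

Definition poset_rank (d : Order.disp_t) (P : finTBPOrderType d) : nat :=
  rank (\top : P).

Definition graded (d : Order.disp_t) (P : finTBPOrderType d) : Prop :=
  graded_interval (\bot : P) \top.

Definition eulerian (d : Order.disp_t) (P : finTBPOrderType d) : Prop :=
  graded P /\
  forall x y : P, x < y ->
    #|[set z in interval x y | ~~ odd (rank z)]|
    = #|[set z in interval x y | odd (rank z)]|.

(* [B] and [D] are the binomial and Sheffer factorial functions of P; their
   values at lengths that no relevant interval of P has are unconstrained. *)
Definition sheffer (d : Order.disp_t) (P : finTBPOrderType d)
    (B D : nat -> nat) : Prop :=
  [/\ forall x y : P, x <= y -> graded_interval x y,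
      forall y : P,
        #|maximal_chains \bot y| = D (interval_length \bot y)
    & forall x y : P, x != \bot -> x <= y ->
        #|maximal_chains x y| = B (interval_length x y)].

Definition poset_iso (d1 d2 : Order.disp_t)
    (P : porderType d1) (Q : porderType d2) : Prop :=
  exists f : P -> Q, bijective f /\ {mono f : x y / x <= y}.

Definition boolean_lattice (n : nat)
    : tbPOrderType Order.SetSubsetOrder.subset_display :=
  Order.SetSubsetOrder.type Order.SetSubsetOrder.subset_display 'I_n.

Lemma boolean_lattice_leE (n : nat) (X Y : {set 'I_n}) :
  ((X : boolean_lattice n) <= (Y : boolean_lattice n)) = (X \subset Y).
Proof. by []. Qed.

(* The k copies of Q form 'I_k * Q. The quotient gluing all the (i, \bot)
   together and all the (i, \top) together is represented by its normal forms,
   the glued elements being represented in copy 0; see [boxplus_pi] below for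
   the quotient map. *)
Section Boxplus.
Context {d : Order.disp_t}.
Variables (k : nat) (Q : tbPOrderType d).

Definition glued (q : Q) : bool := (q == \bot) || (q == \top).

Record boxplus : Type := Boxplus {
  boxplus_val :> 'I_k * Q;
  _ : glued boxplus_val.2 ==> (boxplus_val.1 == 0%N :> nat) }.

HB.instance Definition _ := [isSub for boxplus_val].
HB.instance Definition _ := [Choice of boxplus by <:].

Definition boxplus_le (u v : boxplus) : bool :=
  (u.2 <= v.2) && [|| u.1 == v.1, u.2 == \bot | v.2 == \top].

Fact boxplus_le_refl : reflexive boxplus_le.
Proof. by move=> u; rewrite /boxplus_le lexx eqxx. Qed.

Fact boxplus_le_anti : antisymmetric boxplus_le.
Proof.
move=> [[i q] Hu] [[j r] Hv]; rewrite /boxplus_le /= in Hu Hv *.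
move=> /andP[/andP[le_qr ij] /andP[le_rq _]]; apply: val_inj => /=.
have eqr : q = r by apply: le_anti; rewrite le_qr.
rewrite {}eqr in Hu ij *; congr pair.
suff gr : (i != j) ==> glued r.
  case: eqVneq gr => //= _ gr; apply: val_inj.
  by move: Hu Hv; rewrite gr /= => /eqP -> /eqP ->.
by move: ij; rewrite /glued; case: eqVneq.
Qed.

Fact boxplus_le_trans : transitive boxplus_le.
Proof.
move=> v u w /andP[le_uv uv] /andP[le_vw vw].
rewrite /boxplus_le (le_trans le_uv le_vw) /=.
case/or3P: uv => [/eqP -> | -> | /eqP vt]; rewrite ?orbT //; last first.
  by move: le_vw; rewrite vt le1x => ->; rewrite !orbT.
case/or3P: vw => [-> | /eqP vb | ->]; rewrite ?orbT //.
by move: le_uv; rewrite vb lex0 => ->; rewrite !orbT.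
Qed.

HB.instance Definition _ := Order.Le_isPOrder.Build d boxplus
  boxplus_le_refl boxplus_le_anti boxplus_le_trans.

Lemma boxplus_leE (u v : boxplus) : (u <= v) = boxplus_le u v.
Proof. by []. Qed.

End Boxplus.

Section BoxplusQuotient.
Context {d : Order.disp_t}.
Variables (k : nat) (Q : tbPOrderType d).

Definition boxplus_pi_val (p : 'I_k.+1 * Q) : 'I_k.+1 * Q :=
  if glued p.2 then (ord0, p.2) else p.

Fact boxplus_pi_val2 p : (boxplus_pi_val p).2 = p.2.
Proof. by rewrite /boxplus_pi_val; case: ifP. Qed.

Fact boxplus_pi_subproof p :
  glued (boxplus_pi_val p).2 ==> ((boxplus_pi_val p).1 == 0%N :> nat).
Proof. by rewrite /boxplus_pi_val; case: ifP => [|/= ->]; rewrite ?implybT. Qed.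

Definition boxplus_pi (p : 'I_k.+1 * Q) : boxplus k.+1 Q :=
  Boxplus (boxplus_pi_subproof p).

Lemma boxplus_pi_surj (u : boxplus k.+1 Q) : exists p, boxplus_pi p = u.
Proof.
exists (val u); apply: val_inj; case: u => [[i q] /= Hu].
rewrite /boxplus_pi_val /=; case: ifP => // gq.
move: Hu; rewrite gq /= => /eqP i0.
by congr pair; apply: val_inj.
Qed.

Lemma boxplus_pi_eq (i j : 'I_k.+1) (q r : Q) :
  (boxplus_pi (i, q) == boxplus_pi (j, r)) = (q == r) && ((i == j) || glued q).
Proof.
rewrite -val_eqE /= /boxplus_pi_val /=.
have [-> /=|ne] := eqVneq q r.
  by case: ifP => _; rewrite xpair_eqE !eqxx ?orbT ?orbF ?andbT.
by do 2!case: ifP => _; rewrite xpair_eqE (negbTE ne) andbF.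
Qed.

Lemma boxplus_pi_le (i j : 'I_k.+1) (q r : Q) :
  (boxplus_pi (i, q) <= boxplus_pi (j, r))
  = (q <= r) && [|| i == j, q == \bot | r == \top].
Proof.
rewrite boxplus_leE /boxplus_le /= !boxplus_pi_val2 /=.
have [le_qr|//] := boolP (q <= r).
have [|q0] := eqVneq q \bot; first by rewrite !orbT.
have [|r1] := eqVneq r \top; first by rewrite !orbT.
have q1 : q != \top by apply: contraNneq r1 => q1; rewrite -le1x -q1.
have r0 : r != \bot by apply: contraNneq q0 => r0; rewrite -lex0 -r0.
by rewrite /boxplus_pi_val /glued /= (negbTE q0) (negbTE q1) (negbTE r0)
  (negbTE r1).
Qed.

End BoxplusQuotient.

(* Main.v *)
From mathcomp Require Import all_boot all_order all_algebra zify ring.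
Require Import Defs.
Set Implicit Arguments.
Unset Strict Implicit.
Unset Printing Implicit Defensive.
Import Order.TTheory.

(* Call an interval of length r boolean-like if each of its subintervals has as
   many atoms, and as many coatoms, as its length.  Such an interval is a boolean
   lattice: every atom is missed by exactly one coatom, so elements are determined
   by the atoms below them, and every set of atoms occurs.

   All intervals of length less than n are boolean-like, and so is P itself when n
   is even or n = 3.  Lengths at most 3 follow from the Euler relation and from
   B(3) = D(3) = 6.  Suppose this is known up to length m - 2, with m even.  In an
   interval of odd length m - 1 >= 5, lying below a common element of rank 2 is an
   equivalence relation on the atoms, with classes of size m - 1; hence the number
   of atoms is a multiple of m - 1.  In an interval of length m let f_i be the
   number of elements of rank i, and let (m - 1) l and (m - 1) k be the numbers of
   upper covers of its atoms and of lower covers of its coatoms.  Counting covering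
   pairs gives f_i = f_2 C(m, i) / C(m, 2) for 2 <= i <= m - 2 and
   f_1 (m - 1) l = f_(m-1) (m - 1) k = 2 f_2, and the Euler relation becomes
   2 m + 4 f_2 = (f_1 + f_(m-1)) m, which forces k = l = 1 and f_1 = f_(m-1) = m.

   When n >= 5 is odd, the same equivalence relation splits the atoms of P into k
   classes of size n, and each class spans a copy of B_n. *)

(** * Covers and maximal chains *)

Section Chains.
Local Open Scope order_scope.
Context {d : Order.disp_t} {P : finTBPOrderType d}.
Implicit Types (x y z : P) (C : {set P}).

Definition covers x y : bool := (x < y) && [forall z, ~~ (x < z < y)].

Lemma covers_between x y z : covers x y -> x < z -> ~~ (z < y).
Proof. by case/andP=> _ /forallP/(_ z); rewrite negb_and => /orP[/negP|]. Qed.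

Lemma is_chainP C :
  reflect (forall a b, a \in C -> b \in C -> a >=< b) (is_chain C).
Proof.
apply: (iffP forall_inP) => [h a b aC bC | h a aC].
  by move/forall_inP: (h a aC); apply.
by apply/forall_inP => b bC; apply: h.
Qed.

(** Maximality can be tested one element at a time: a larger chain in the interval would supply an
    element comparable to all of [C]. *)
Lemma maximal_chainsP x y C :
  reflect [/\ is_chain C, C \subset interval x y
            & forall z, x <= z <= y -> (forall c, c \in C -> z >=< c) -> z \in C]
          (C \in maximal_chains x y).
Proof.
rewrite inE; apply: (iffP maxsetP) => [[/andP[chC sC] mx] | [chC sC mx]].
  split=> // z zI zC; suff <- : z |: C = C by rewrite setU11.
  apply: mx (subsetUr _ _); rewrite subUset sub1set sC inE zI !andbT.
  apply/is_chainP => a b /setU1P[->|aC] /setU1P[->|bC].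
  - exact: comparablexx.
  - exact: zC.
  - by rewrite comparable_sym zC.
  - by move/is_chainP: chC; apply.
rewrite chC sC; split=> // C' /andP[/is_chainP chC' sC'] CC'.
apply/eqP; rewrite eqEsubset CC' andbT; apply/subsetP => z zC'.
apply: mx => [|c cC]; first by move: (subsetP sC' z zC'); rewrite inE.
by apply: chC' => //; apply: (subsetP CC').
Qed.

Lemma maximal_chains_exists x y : exists C, C \in maximal_chains x y.
Proof.
have: is_chain (set0 : {set P}) && (set0 \subset interval x y).
  by rewrite sub0set andbT; apply/is_chainP => a b; rewrite inE.
by case/(@maxset_exists _ (fun C => is_chain C && (C \subset interval x y)))
  => C mC _; exists C; rewrite inE.
Qed.

Lemma maximal_chains_itv x y C z :
  C \in maximal_chains x y -> z \in C -> x <= z <= y.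
Proof. by case/maximal_chainsP=> _ /subsetP h _ /h; rewrite inE. Qed.

Lemma maximal_chains_bounds x y C :
  x <= y -> C \in maximal_chains x y -> (x \in C) * (y \in C).
Proof.
move=> xy mC; have itv := maximal_chains_itv mC.
case/maximal_chainsP: mC => _ _ mx.
by split; apply: mx; rewrite ?lexx ?xy // => c /itv/andP[xc cy];
  rewrite /Order.comparable ?xc ?cy ?orbT.
Qed.

Lemma maximal_chains_diag x : maximal_chains x x = [set [set x]].
Proof.
apply/setP => C; rewrite !inE; apply/idP/eqP => [|->].
  move=> mC; have {}mC : C \in maximal_chains x x by rewrite inE.
  apply/setP => z; rewrite inE; apply/idP/eqP => [|->].
    by move/(maximal_chains_itv mC); move/le_anti.
  by rewrite !(maximal_chains_bounds _ mC).
suff: [set x] \in maximal_chains x x by rewrite inE.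
apply/maximal_chainsP; split=> [||z /le_anti <- _]; rewrite ?set11 //.
  by apply/is_chainP => a b /set1P-> /set1P->; exact: comparablexx.
by rewrite sub1set inE lexx.
Qed.

Lemma covers_exists x y : x < y -> exists2 z, covers x z & z <= y.
Proof.
move=> xy; have p0 : (x < y) && (y <= y) by rewrite xy lexx.
(* Among the elements of [(x, y]], one with the smallest interval [[x, z]] covers [x]. *)
have [z /andP[xz zy] zmin] :=
  @arg_minnP _ y (fun z => x < z <= y) (fun z => #|interval x z|) p0.
exists z => //; rewrite /covers xz; apply/forallP => t; apply/negP => /andP[xt tz].
have /zmin : (x < t) && (t <= y) by rewrite xt (le_trans (ltW tz) zy).
apply/negP; rewrite -ltnNge; apply: proper_card; rewrite properE; apply/andP; split.
  by apply/subsetP => u; rewrite !inE => /andP[-> ut]; rewrite (le_trans ut (ltW tz)).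
apply/subsetPn; exists z; rewrite !inE ?lexx ?(ltW xz) //=.
by rewrite lt_geF.
Qed.

(** Each step strictly shrinks [[u, x]], so climbing by covers reaches [x]. *)
Lemma covers_ind x (K : P -> Prop) :
  K x -> (forall u v, covers u v -> v <= x -> K v -> K u) ->
  forall u, u <= x -> K u.
Proof.
move=> Kx Ks u; have [m] := ubnP #|interval u x|.
elim: m u => // m IH u um ux; have [->//|neq] := eqVneq u x.
have [v uv vx] : exists2 z, covers u z & z <= x.
  by apply: covers_exists; rewrite lt_neqAle neq.
have uv' : u < v by case/andP: uv.
apply: (Ks _ v) => //; apply: IH => //; rewrite ltnS in um.
apply: leq_trans um; apply: proper_card; rewrite properE; apply/andP; split.
  by apply/subsetP => t; rewrite !inE => /andP[vt ->]; rewrite (le_trans (ltW uv') vt).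
by apply/subsetPn; exists u; rewrite !inE ?lexx ?ux //= lt_geF.
Qed.

(** Together with [maximal_chains_behead], adding and removing [x] matches the maximal chains of
    [[z, y]] with those of [[x, y]] through the cover [z]. *)
Lemma maximal_chains_cons x z y C : covers x z -> z <= y ->
  C \in maximal_chains z y ->
  (x |: C \in maximal_chains x y) * (x \notin C).
Proof.
move=> xz zy mC; have itv := maximal_chains_itv mC.
have xz' : x < z by case/andP: xz.
have xltC c : c \in C -> x < c by case/itv/andP=> zc _; exact: lt_le_trans zc.
have xC : x \notin C by apply/negP => /xltC; rewrite ltxx.
split=> //; have zC := (maximal_chains_bounds zy mC).1.
case/maximal_chainsP: mC => /is_chainP chC /subsetP sC mx.
apply/maximal_chainsP; split.
- apply/is_chainP => a b /setU1P[->|aC] /setU1P[->|bC].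
  + exact: comparablexx.
  + by rewrite /Order.comparable (ltW (xltC _ bC)).
  + by rewrite /Order.comparable (ltW (xltC _ aC)) orbT.
  + exact: chC.
- apply/subsetP => c /setU1P[->|cC]; rewrite inE.
    by rewrite lexx (le_trans (ltW xz') zy).
  by rewrite (ltW (xltC _ cC)); case/andP: (itv _ cC).
- move=> t /andP[xt ty] tC; apply/setU1P.
  have [->|ntx] := eqVneq t x; [by left | right].
  have xt' : x < t by rewrite lt_neqAle eq_sym ntx.
  have zt : z <= t.
    have /orP[tz|//] := tC z (setU1r _ zC).
    move: (covers_between xz xt'); rewrite lt_neqAle tz andbT negbK.
    by move/eqP->.
  by apply: mx => [|c cC]; rewrite ?zt //; apply/tC/setU1r.
Qed.

Lemma maximal_chains_behead x z y C : covers x z -> z <= y ->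
  C \in maximal_chains x y -> z \in C -> C :\ x \in maximal_chains z y.
Proof.
move=> xz zy mC zC; have itv := maximal_chains_itv mC.
have xz' : x < z by case/andP: xz.
case/maximal_chainsP: mC => /is_chainP chC /subsetP sC mx.
apply/maximal_chainsP; split.
- by apply/is_chainP => a b /setD1P[_ aC] /setD1P[_ bC]; apply: chC.
- apply/subsetP => c /setD1P[ncx cC]; rewrite inE.
  have /andP[xc ->] := itv c cC; rewrite andbT.
  have /orP[//|cz] := chC z c zC cC.
  have xc' : x < c by rewrite lt_neqAle eq_sym ncx.
  move: (covers_between xz xc'); rewrite lt_neqAle cz andbT negbK.
  by move/eqP->.
- move=> t /andP[zt ty] tC; have xt := lt_le_trans xz' zt.
  rewrite !inE (gt_eqF xt) /=; apply: mx => [|c cC]; first by rewrite (ltW xt).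
  have [->|ncx] := eqVneq c x; first by rewrite /Order.comparable (ltW xt) orbT.
  by apply: tC; rewrite !inE ncx.
Qed.

Lemma maximal_chains_second x y C : x < y -> C \in maximal_chains x y ->
  exists2 z, covers x z & z \in C.
Proof.
move=> xy mC; have itv := maximal_chains_itv mC.
have yC := (maximal_chains_bounds (ltW xy) mC).2.
case/maximal_chainsP: mC => /is_chainP chC _ mx.
have p0 : (x < y) && (y \in C) by rewrite xy.
(* On a chain the size of [[x, z]] grows with [z], so the minimiser is the least member above [x];
   maximality of the chain makes it a cover. *)
have [z /andP[xz zC] zmin] :=
  @arg_minnP _ y (fun z => (x < z) && (z \in C)) (fun z => #|interval x z|) p0.
have zle c : c \in C -> c != x -> z <= c.
  move=> cC ncx; have /orP[//|cz] := chC z c zC cC.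
  have [->//|ncz] := eqVneq z c.
  have /zmin : (x < c) && (c \in C).
    by rewrite lt_neqAle eq_sym ncx cC andbT; case/andP: (itv c cC).
  rewrite leqNgt => /negP[]; apply: proper_card; rewrite properE; apply/andP; split.
    by apply/subsetP => u; rewrite !inE => /andP[-> ut]; rewrite (le_trans ut cz).
  apply/subsetPn; exists z; rewrite !inE ?lexx ?(ltW xz) //=.
  by rewrite lt_geF // lt_neqAle eq_sym ncz.
exists z => //; rewrite /covers xz; apply/forallP => t; apply/negP => /andP[xt tz].
have tC : t \in C.
  apply: mx => [|c cC].
    by rewrite (ltW xt) /=; case/andP: (itv z zC) => _; apply/le_trans/ltW.
  have [->|ncx] := eqVneq c x; first by rewrite /Order.comparable (ltW xt) orbT.
  by rewrite /Order.comparable (le_trans (ltW tz) (zle c cC ncx)).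
by move: (zle t tC); rewrite (gt_eqF xt) lt_geF // => /(_ isT).
Qed.

(** Maximal chains are sorted by their second element: each contains a cover of [x], and only one,
    since two distinct covers of [x] are incomparable. *)
Lemma card_maximal_chains x y : x < y ->
  #|maximal_chains x y| =
  (\sum_(z | covers x z && (z <= y)%O) #|maximal_chains z y|)%N.
Proof.
move=> xy; transitivity (\sum_(z | covers x z && (z <= y)%O)
    \sum_(C in maximal_chains x y) (z \in C : nat))%N; last first.
  apply: eq_bigr => z /andP[xz zy].
  transitivity #|[set C in maximal_chains x y | z \in C]|; last first.
    have -> : maximal_chains z y =
              [set C :\ x | C in [set C in maximal_chains x y | z \in C]].
      apply/setP => C; apply/idP/imsetP => [mC | [C' /setIdP[mC' zC'] ->]].
        have [mxC xC] := maximal_chains_cons xz zy mC.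
        exists (x |: C); rewrite ?setU1K //; apply/setIdP; split=> //.
        by rewrite inE (maximal_chains_bounds zy mC).1 orbT.
      exact: maximal_chains_behead.
    rewrite card_in_imset // => C1 C2 /setIdP[m1 _] /setIdP[m2 _] e.
    have x1 := (maximal_chains_bounds (ltW xy) m1).1.
    have x2 := (maximal_chains_bounds (ltW xy) m2).1.
    by rewrite -(setD1K x1) e setD1K.
  by rewrite -sum1dep_card big_mkcondr /=; apply: eq_bigr => C _; case: (z \in C).
rewrite exchange_big -sum1_card /=; apply: eq_bigr => C mC.
have [z xz zC] := maximal_chains_second xy mC.
have /andP[_ zy] := maximal_chains_itv mC zC.
rewrite (bigD1 z) /= ?xz // zC big1 ?addn0 // => t /andP[/andP[xt _] ntz].
apply/eqP; rewrite eqb0; apply/negP => tC.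
have /maximal_chainsP[/is_chainP chC _ _] := mC.
have /andP[xz' _] := xz; have /andP[xt' _] := xt.
move: (covers_between xz xt') (covers_between xt xz').
rewrite !lt_neqAle [z == t]eq_sym ntz /=.
by have /orP[->|->] := chC t z tC zC.
Qed.

End Chains.

(** * Ranks, levels and counting of covering pairs *)

Section Graded.
Local Open Scope order_scope.
Context {d : Order.disp_t} {P : finTBPOrderType d}.
Implicit Types (x y z w a b c : P) (S : {set P}).

(** Heights are measured by the rank in the whole of [P] rather than by covers, which reduces
    comparisons to arithmetic; [atomsE] recovers the covers. *)
Definition level x y i : {set P} :=
  [set z in interval x y | rank z == (rank x + i)%N].
Definition atoms x y : {set P} :=
  [set z in interval x y | rank z == (rank x).+1].
Definition coatoms x y : {set P} :=
  [set z in interval x y | (rank z).+1 == rank y].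

Lemma in_interval x y z : (z \in interval x y) = (x <= z <= y).
Proof. by rewrite inE. Qed.

Lemma in_level x y i z :
  (z \in level x y i) = [&& x <= z, z <= y & rank z == (rank x + i)%N].
Proof. by rewrite !inE andbA. Qed.

Lemma in_atoms x y z :
  (z \in atoms x y) = [&& x <= z, z <= y & rank z == (rank x).+1].
Proof. by rewrite !inE andbA. Qed.

Lemma in_coatoms x y z :
  (z \in coatoms x y) = [&& x <= z, z <= y & (rank z).+1 == rank y].
Proof. by rewrite !inE andbA. Qed.

Lemma atomsS x y z : y <= z -> atoms x y \subset atoms x z.
Proof.
move=> yz; apply/subsetP => a; rewrite !in_atoms => /and3P[-> ay ->].
by rewrite (le_trans ay yz).
Qed.

Hypothesis gr : forall x y : P, x <= y -> graded_interval x y.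

Lemma interval_lengthE x y C : x <= y -> C \in maximal_chains x y ->
  interval_length x y = #|C|.-1.
Proof.
move=> xy mC; apply/eqP; rewrite eqn_leq; apply/andP; split.
  by apply/bigmax_leqP => C' mC'; rewrite (gr xy mC mC').
exact: (bigop.bigmax_sup C).
Qed.

Lemma interval_length_diag x : interval_length x x = 0%N.
Proof.
rewrite (@interval_lengthE x x [set x]) ?cards1 //.
by rewrite maximal_chains_diag set11.
Qed.

Lemma interval_length_covers x z y : covers x z -> z <= y ->
  interval_length x y = (interval_length z y).+1.
Proof.
move=> xz zy; have [C mC] := maximal_chains_exists z y.
have [mxC xC] := maximal_chains_cons xz zy mC.
have xy : x <= y by apply: le_trans zy; case/andP: xz => /ltW.
rewrite (interval_lengthE xy mxC) (interval_lengthE zy mC) cardsU1 xC add1n /=.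
by rewrite prednK //; apply/card_gt0P; exists z; rewrite (maximal_chains_bounds zy mC).
Qed.

Lemma interval_length_add u x y : u <= x -> x <= y ->
  interval_length u y = (interval_length u x + interval_length x y)%N.
Proof.
move=> ux xy; move: u ux.
apply: (@covers_ind _ _ x (fun u => interval_length u y =
  (interval_length u x + interval_length x y)%N)).
  by rewrite interval_length_diag.
move=> u v uv vx IH.
by rewrite (interval_length_covers uv vx) (interval_length_covers uv (le_trans vx xy)) IH.
Qed.

Lemma rank_interval_length x y : x <= y ->
  rank y = (rank x + interval_length x y)%N.
Proof. by move=> xy; rewrite /rank (interval_length_add (le0x x)). Qed.

Lemma interval_length_rank x y : x <= y -> interval_length x y = (rank y - rank x)%N.
Proof. by move/rank_interval_length->; rewrite addKn. Qed.

Lemma rank_bot : rank (\bot : P) = 0%N.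
Proof. exact: interval_length_diag. Qed.

Lemma rank_covers x y : covers x y -> rank y = (rank x).+1.
Proof.
move=> xy; have /andP[/ltW xy' _] := xy.
by rewrite (rank_interval_length xy') (interval_length_covers xy) //
  interval_length_diag addn1.
Qed.

Lemma rank_le x y : x <= y -> (rank x <= rank y)%N.
Proof. by move/rank_interval_length->; apply: leq_addr. Qed.

Lemma rank_lt x y : x < y -> (rank x < rank y)%N.
Proof.
by move=> /covers_exists[z /rank_covers xz /rank_le zy]; rewrite -xz.
Qed.

Lemma rank_le_eq x y : x <= y -> (rank y <= rank x)%N -> x = y.
Proof.
move=> xy ryx; apply: contraTeq ryx => nxy; rewrite -ltnNge.
by apply: rank_lt; rewrite lt_neqAle nxy.
Qed.

Lemma lt_rank x y : x <= y -> (rank x < rank y)%N -> x < y.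
Proof. by move=> xy; rewrite lt_neqAle xy andbT; apply: contraTneq => ->; rewrite ltnn. Qed.

Lemma coversE x y : covers x y = (x <= y) && (rank y == (rank x).+1).
Proof.
apply/idP/andP => [xy|[xy /eqP rxy]].
  by rewrite (rank_covers xy); case/andP: xy => /ltW.
rewrite /covers lt_rank ?rxy //=; apply/forallP => t; apply/negP.
by case/andP=> /rank_lt h1 /rank_lt; rewrite rxy ltnNge h1.
Qed.

Lemma atomsE x y z : (z \in atoms x y) = covers x z && (z <= y).
Proof. by rewrite in_atoms coversE -andbA [(z <= y) && _]andbC. Qed.

Lemma level_exists x y i : x <= y -> (i <= rank y - rank x)%N ->
  exists z, z \in level x y i.
Proof.
move=> xy; elim: i => [_|i IH ile].
  by exists x; rewrite in_level lexx xy addn0 eqxx.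
have [z] := IH (ltnW ile); rewrite in_level => /and3P[xz zy /eqP rz].
have [t zt ty] : exists2 t, covers z t & t <= y.
  by apply/covers_exists/lt_rank => //; rewrite rz; lia.
exists t; rewrite in_level ty (rank_covers zt) rz addnS eqxx.
by case/andP: zt => /ltW /(le_trans xz) ->.
Qed.

Lemma level0 x y : x <= y -> level x y 0 = [set x].
Proof.
move=> xy; apply/setP => z; rewrite in_level inE addn0.
apply/and3P/eqP => [[xz _ /eqP rz]|->]; last by rewrite lexx eqxx.
by apply/esym/rank_le_eq; rewrite ?rz.
Qed.

Lemma level_top x y : x <= y -> level x y (rank y - rank x) = [set y].
Proof.
move=> xy; apply/setP => z; rewrite in_level inE subnKC ?rank_le //.
apply/and3P/eqP => [[_ zy /eqP rz]|->]; last by rewrite xy lexx eqxx.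
by apply/rank_le_eq; rewrite ?rz.
Qed.

Lemma level1 x y : level x y 1 = atoms x y.
Proof. by apply/setP => z; rewrite in_level in_atoms addn1. Qed.

Lemma level_coatoms x y m : rank y = (rank x + m.+1)%N ->
  level x y m = coatoms x y.
Proof. by move=> r; apply/setP => z; rewrite in_level in_coatoms r addnS eqSS. Qed.

Lemma atoms_diag x : atoms x x = set0.
Proof.
apply/setP => z; rewrite in_atoms inE; apply/negP => /and3P[_ /rank_le zx /eqP rz].
by move: zx; rewrite rz ltnn.
Qed.

Lemma atoms_gt0 x y : x < y -> (0 < #|atoms x y|)%N.
Proof.
case/covers_exists=> z xz zy; apply/card_gt0P; exists z.
by rewrite atomsE xz.
Qed.

(** Both sides count the pairs [z <= w] with [z] in level [i] and [w] in level [i.+1]. *)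
Lemma level_double_count x y i :
  (\sum_(z in level x y i) #|atoms z y| =
   \sum_(w in level x y i.+1) #|coatoms x w|)%N.
Proof.
transitivity (\sum_(z in level x y i) \sum_(w in level x y i.+1) ((z <= w)%O : nat))%N.
  apply: eq_bigr => z; rewrite in_level => /and3P[xz zy /eqP rz].
  rewrite -sum1_card big_mkcond [RHS]big_mkcond /=; apply: eq_bigr => w _.
  rewrite in_atoms in_level rz addnS; case: (rank w =P _); rewrite ?andbF // => rw.
  rewrite !andbT; have [zw|] := boolP (z <= w); last by rewrite if_same.
  by rewrite (le_trans xz zw); case: (w <= y).
rewrite exchange_big /=; apply: eq_bigr => w; rewrite in_level => /and3P[xw wy /eqP rw].
rewrite -sum1_card big_mkcond [RHS]big_mkcond /=; apply: eq_bigr => z _.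
rewrite in_coatoms in_level rw addnS eqSS.
case: (rank z =P _); rewrite ?andbF // => rz; rewrite !andbT.
have [zw|] := boolP (z <= w); last by rewrite andbF if_same.
by rewrite (le_trans zw wy) !andbT; case: (x <= z).
Qed.

Lemma level_ratio x y i p q :
  (forall z, z \in level x y i -> #|atoms z y| = p) ->
  (forall w, w \in level x y i.+1 -> #|coatoms x w| = q) ->
  (#|level x y i| * p = #|level x y i.+1| * q)%N.
Proof.
move=> hp hq; rewrite -!sum_nat_const.
transitivity (\sum_(z in level x y i) #|atoms z y|)%N.
  by apply: eq_bigr => z /hp ->.
by rewrite level_double_count; apply: eq_bigr => w /hq ->.
Qed.

(** Quantifying over all intervals of length at most [m] makes the condition pass to subintervals,
    so each of these intervals is boolean-like. *)
Definition boolean_counts m : Prop :=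
  forall x y, x <= y -> (rank y - rank x <= m)%N ->
    #|atoms x y| = (rank y - rank x)%N /\ #|coatoms x y| = (rank y - rank x)%N.

Lemma boolean_countsW m m' : (m <= m')%N -> boolean_counts m' -> boolean_counts m.
Proof. by move=> mm' h x y xy le; apply: h (leq_trans le mm'). Qed.

(** The binomials satisfy the same recursion, ['C(m, i) * (m - i) = 'C(m, i.+1) * i.+1], so the
    level sizes are proportional to them; cross multiplication avoids division. *)
Lemma level_binomial x y j k m :
  (j <= k)%N ->
  (forall i, (j <= i < k)%N ->
     (#|level x y i| * (m - i) = #|level x y i.+1| * i.+1)%N) ->
  (k <= m)%N ->
  (#|level x y k| * 'C(m, j) = #|level x y j| * 'C(m, k))%N.
Proof.
elim: k => [|k IH]; first by rewrite leqn0 => /eqP->.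
rewrite leq_eqVlt => /predU1P[-> //|]; rewrite ltnS => jk h km.
have {}IH : (#|level x y k| * 'C(m, j) = #|level x y j| * 'C(m, k))%N.
  by apply: IH => // [i /andP[ji ik]|]; [apply: h; rewrite ji ltnS ltnW | exact: ltnW].
have hk : (#|level x y k| * (m - k) = #|level x y k.+1| * k.+1)%N by apply: h; rewrite jk /=.
apply/eqP; rewrite -(@eqn_pmul2r k.+1) //; apply/eqP.
rewrite mulnAC -hk -[in RHS]mulnA ['C(m, k.+1) * _]mulnC mul_bin_left.
by rewrite [(_ - _) * 'C(_, _)]mulnC [RHS]mulnA -IH mulnAC.
Qed.

End Graded.

(* [lia] with the order-theoretic hypotheses cleared, which its preprocessing
   handles very slowly. *)
Ltac rank_lia :=
  repeat match goal with
  | H : is_true (@Order.le _ _ _ _) |- _ => clear H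
  | H : is_true (@Order.lt _ _ _ _) |- _ => clear H
  | H : is_true (_ \in _) |- _ => clear H
  | H : is_true (_ \subset _) |- _ => clear H
  | H : is_true (~~ _) |- _ => clear H
  | H : forall _, _ |- _ => clear H
  | H : boolean_counts _ |- _ => clear H
  | H : _ = _ :> {set _} |- _ => clear H
  end; lia.

(** * Elements of boolean-like intervals as sets of atoms *)

Section BooleanIntervals.
Local Open Scope order_scope.
Context {d : Order.disp_t} {P : finTBPOrderType d}.
Implicit Types (x y z w t a b c : P) (S : {set P}).
Hypothesis gr : forall x y : P, x <= y -> graded_interval x y.
Variable m : nat.
Hypothesis bc : @boolean_counts d P m.

(** The coatoms of [[x, w]] above [a] are the coatoms of [[a, w]], an interval shorter by one, hence
    with one coatom fewer. *)
Lemma card_coatoms_missing x w a : (rank w - rank x <= m)%N ->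
  a \in atoms x w -> #|[set c in coatoms x w | ~~ (a <= c)]| = 1%N.
Proof.
rewrite in_atoms => le /and3P[xa aw /eqP ra].
have [_ cxw] := bc (le_trans xa aw) le.
have := rank_le gr aw; rewrite ra => law.
have [|_ caw] := bc aw; first by rewrite ra; rank_lia.
have := cardsID [set c | a <= c] (coatoms x w).
have -> : coatoms x w :&: [set c | a <= c] = coatoms a w.
  apply/setP => c; rewrite in_setI !in_coatoms inE andbC.
  by have [ac|//] := boolP (a <= c); rewrite (le_trans xa ac).
have -> : coatoms x w :\: [set c | a <= c] = [set c in coatoms x w | ~~ (a <= c)].
  by apply/setP => c; rewrite !inE andbC.
by rewrite cxw caw ra; rank_lia.
Qed.

(* As many coatoms of [w] lie above [z] as there are atoms of [w] not below
   [z], each of them misses one of these atoms, and no atom is missed twice. *)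
Lemma coatom_missing x z w a : x <= z -> z <= w -> (rank w - rank x <= m)%N ->
  a \in atoms x w -> ~~ (a <= z) -> exists2 c, c \in coatoms z w & ~~ (a <= c).
Proof.
move=> xz zw le aA naz; apply/exists_inP; apply: contraT.
rewrite negb_exists_in => /forall_inP all_a; exfalso.
have xw := le_trans xz zw; have lez := rank_le gr zw; have lex := rank_le gr xz.
pose E := (atoms x w :\: atoms x z) :\ a.
pose miss b := [set c in coatoms x w | ~~ (b <= c)].
have sub : coatoms z w \subset \bigcup_(b in E) miss b.
  apply/subsetP => c cC; have := all_a c cC; rewrite negbK => ac.
  move: (cC); rewrite in_coatoms => /and3P[zc cw /eqP rc].
  have xc := le_trans xz zc; have lec := rank_le gr xc.
  have [axw _] := bc xw le.
  have [axc _] : _ /\ _ := bc xc (ltac:(rank_lia)).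
  have : ~~ (atoms x w \subset atoms x c).
    by apply/negP => /subset_leq_card; rewrite axw axc; rank_lia.
  case/subsetPn=> b bw; rewrite in_atoms => nbc.
  have /and3P[xb bw' rb] : [&& x <= b, b <= w & rank b == (rank x).+1].
    by rewrite -in_atoms.
  rewrite xb rb andbT /= in nbc.
  apply/bigcupP; exists b; rewrite !inE ?bw' ?xb ?rb ?nbc ?xc ?cw ?rc ?eqxx //=.
  rewrite !andbT; apply/andP; split; first by apply: contraNneq nbc => ->.
  by apply: contra nbc => bz; apply: le_trans zc.
have le1 : (#|\bigcup_(b in E) miss b| <= \sum_(b in E) #|miss b|)%N.
  apply: (big_ind2 (fun (A : {set P}) k => (#|A| <= k)%N)) => [|A1 k1 A2 k2 h1 h2|//].
    by rewrite cards0.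
  by apply: leq_trans (leq_add h1 h2); rewrite cardsU leq_subr.
have := leq_trans (subset_leq_card sub) le1.
have -> : (\sum_(b in E) #|miss b| = #|E|)%N.
  rewrite -sum1_card; apply: eq_bigr => b.
  by rewrite !inE => /and3P[_ _ bA]; rewrite card_coatoms_missing // inE; rewrite !inE.
have [_ ->] : _ /\ _ := bc zw (ltac:(rank_lia)).
have aE : a \in atoms x w :\: atoms x z by rewrite inE aA andbT in_atoms (negbTE naz) andbF.
have := cardsD1 a (atoms x w :\: atoms x z); rewrite aE cardsD.
rewrite (setIidPr (atomsS _ zw)) (bc xw le).1 (bc xz (ltac:(rank_lia))).1 -/E.
by rank_lia.
Qed.

(** Induction on [rank y]. If [w] is not [y], some atom [a] is not below [w], hence not below [z].
    By [coatom_missing] each of [w] and [z] lies below a coatom missing [a]; there is only one such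
    coatom, and it replaces [y]. *)
Lemma le_of_atoms x y z w : (rank y - rank x <= m)%N ->
  x <= z -> z <= y -> x <= w -> w <= y -> atoms x z \subset atoms x w -> z <= w.
Proof.
have [k] := ubnP (rank y); elim: k y => // k IH y yk le xz zy xw wy sub.
have [-> //|nwy] := eqVneq w y.
have ltwy : w < y by rewrite lt_neqAle nwy.
have ltr := rank_lt gr ltwy; have ler := rank_le gr xw.
have : ~~ (atoms x y \subset atoms x w).
  apply/negP => /subset_leq_card.
  rewrite (bc (le_trans xw wy) le).1 (bc xw (ltac:(rank_lia))).1; rank_lia.
case/subsetPn=> a aA naw; have := aA; rewrite in_atoms => /and3P[xa ay ra].
have naw' : ~~ (a <= w) by move: naw; rewrite in_atoms xa ra andbT.
have naz : ~~ (a <= z).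
  by move: (contra (subsetP sub a) naw); rewrite in_atoms xa ra andbT.
have [c1] := coatom_missing xw wy le aA naw'; rewrite in_coatoms => /and3P[wc1 c1y rc1] nac1.
have [c2] := coatom_missing xz zy le aA naz; rewrite in_coatoms => /and3P[zc2 c2y rc2] nac2.
have /eqP/cards1P[c mis] := card_coatoms_missing le aA.
have e1 : c1 = c.
  by apply/set1P; rewrite -mis inE nac1 in_coatoms (le_trans xw wc1) c1y rc1.
have e2 : c2 = c.
  by apply/set1P; rewrite -mis inE nac2 in_coatoms (le_trans xz zc2) c2y rc2.
rewrite e1 in wc1 rc1 c1y; rewrite e2 in zc2; move/eqP: rc1 => rc.
by apply: (IH c) => //; rank_lia.
Qed.

(** As long as [S] omits an atom [a], the coatom missing [a] lies above all the other atoms, and [y]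
    can be lowered to it. *)
Lemma atoms_surj x y S : x <= y -> (rank y - rank x <= m)%N -> S \subset atoms x y ->
  exists z, [/\ x <= z, z <= y & atoms x z = S].
Proof.
have [k] := ubnP (rank y); elim: k y => // k IH y yk xy le sub.
have [->|nS] := eqVneq S (atoms x y); first by exists y; rewrite lexx.
have : ~~ (atoms x y \subset S) by apply: contra nS => h; rewrite eqEsubset sub.
case/subsetPn=> a aA naS; have := aA; rewrite in_atoms => /and3P[xa ay /eqP ra].
have lea := rank_le gr ay; rewrite ra in lea.
have nax : ~~ (a <= x) by apply/negP => /(rank_le gr); rewrite ra ltnn.
have [c] := coatom_missing (lexx x) xy le aA nax.
rewrite in_coatoms => /and3P[xc cy /eqP rc] nac; have lec := rank_le gr xc.
have ac : atoms x c = atoms x y :\ a.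
  apply/eqP; rewrite eqEcard; apply/andP; split.
    apply/subsetP => b bc'; rewrite in_setD1 (subsetP (atomsS _ cy)) // andbT.
    by apply: contraNneq nac => <-; move: bc'; rewrite in_atoms => /and3P[].
  have := cardsD1 a (atoms x y); rewrite aA (bc xy le).1 (bc xc (ltac:(rank_lia))).1; rank_lia.
have [||||z [xz zc zS]] := IH c; rewrite ?ac ?subsetD1 ?sub ?naS //; try rank_lia.
by exists z; split=> //; apply: le_trans cy.
Qed.

End BooleanIntervals.

(** * The adjacency relation on the atoms of an interval of length [m.+1] *)

Section Adjacency.
Local Open Scope order_scope.
Context {d : Order.disp_t} {P : finTBPOrderType d}.
Implicit Types (z w t a b c : P) (S : {set P}).
Hypothesis gr : forall x y : P, x <= y -> graded_interval x y.
Variables (x y : P) (m : nat).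
Hypothesis m3 : (3 <= m)%N.
Hypothesis rxy : rank y = (rank x + m.+1)%N.
Hypothesis bc : @boolean_counts d P m.

(** The rank of the common bound is at most, not exactly, [rank x + 2], so that an atom is adjacent
    to itself. *)
Definition adjacent a b : bool :=
  [exists t, [&& a <= t, b <= t, t <= y & (rank t <= rank x + 2)%N]].

Lemma rank_atom a : a \in atoms x y -> [/\ x <= a, a <= y & rank a = (rank x).+1].
Proof. by rewrite in_atoms => /and3P[-> -> /eqP]. Qed.

(** In [[b, y]], which has length [m], take [w] whose atoms are those below [t1] or [t2]. They are
    at most two, so [w] has height at most 3 over [x], and [3 <= m]. *)
Lemma adjacent_bound b t1 t2 : b \in atoms x y ->
  b <= t1 -> b <= t2 -> t1 <= y -> t2 <= y ->
  (rank t1 <= rank x + 2)%N -> (rank t2 <= rank x + 2)%N ->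
  exists w, [/\ t1 <= w, t2 <= w, w <= y & (rank w - rank x <= m)%N].
Proof.
case/rank_atom=> xb bY rb bt1 bt2 t1y t2y r1 r2.
have h1 := (bc bt1 (ltac:(rank_lia))).1; have h2 := (bc bt2 (ltac:(rank_lia))).1.
have ley : (rank y - rank b <= m)%N by rank_lia.
have [|w [bw wy Sw]] := atoms_surj gr bc (S := atoms b t1 :|: atoms b t2) bY ley.
  by rewrite subUset !atomsS.
have lew := rank_le gr bw; have lew' := rank_le gr wy.
have hw := (bc bw (ltac:(rank_lia))).1.
exists w; split=> //.
- by apply: (le_of_atoms gr bc ley) => //; rewrite Sw subsetUl.
- by apply: (le_of_atoms gr bc ley) => //; rewrite Sw subsetUr.
- move: hw; rewrite Sw cardsU h1 h2; rank_lia.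
Qed.

Lemma adjacent_witness a c w : (rank w - rank x <= m)%N ->
  a \in atoms x w -> c \in atoms x w ->
  exists t, [/\ a <= t, c <= t, t <= w & (rank t <= rank x + 2)%N].
Proof.
move=> lew aw cw; have := aw; rewrite in_atoms => /and3P[xa aw' _].
have xw := le_trans xa aw'.
have [|t [xt tw tS]] := atoms_surj gr bc (S := [set a; c]) xw lew.
  by apply/subsetP => b /set2P[]->.
have lt := rank_le gr tw; have lt' := rank_le gr xt.
have ht := (bc xt (ltac:(rank_lia))).1.
have /and3P[_ at' _] : [&& x <= a, a <= t & rank a == (rank x).+1].
  by rewrite -in_atoms tS set21.
have /and3P[_ ct _] : [&& x <= c, c <= t & rank c == (rank x).+1].
  by rewrite -in_atoms tS set22.
exists t; split=> //.
by move: ht; rewrite tS cards2; case: (a != c); rank_lia.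
Qed.

Lemma adjacent_below a c w : w <= y -> (rank w - rank x <= m)%N ->
  a \in atoms x w -> c \in atoms x w -> adjacent a c.
Proof.
move=> wy lew aw cw; have [t [at' ct tw rt]] := adjacent_witness lew aw cw.
by apply/existsP; exists t; rewrite at' ct (le_trans tw wy).
Qed.

Lemma adjacent_refl a : a \in atoms x y -> adjacent a a.
Proof.
case/rank_atom=> _ ay ra; apply/existsP; exists a.
by rewrite lexx ay ra /=; rank_lia.
Qed.

Lemma adjacent_sym : symmetric adjacent.
Proof. by move=> a b; apply: eq_existsb => t; rewrite andbCA. Qed.

Lemma adjacent_trans a b c :
  a \in atoms x y -> b \in atoms x y -> c \in atoms x y ->
  adjacent a b -> adjacent b c -> adjacent a c.
Proof.
move=> aA bA cA /existsP[t1 /and4P[at1 bt1 t1y r1]] /existsP[t2 /and4P[bt2 ct2 t2y r2]].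
have [w [t1w t2w wy rw]] := adjacent_bound bA bt1 bt2 t1y t2y r1 r2.
case/rank_atom: aA => xa _ ra; case/rank_atom: cA => xc _ rc.
apply: (adjacent_below wy rw).
  by rewrite in_atoms xa ra eqxx (le_trans at1 t1w).
by rewrite in_atoms xc rc eqxx (le_trans ct2 t2w).
Qed.

Lemma adjacent_equiv :
  {in atoms x y & &, equivalence_rel adjacent}.
Proof.
move=> a b c aA bA cA; split; first exact: adjacent_refl.
move=> ab; apply/idP/idP; last exact: adjacent_trans.
by apply: adjacent_trans => //; rewrite adjacent_sym.
Qed.

Lemma adjacent_rank2 a b t : a \in atoms x y -> b \in atoms x y -> a != b ->
  a <= t -> b <= t -> t <= y -> (rank t <= rank x + 2)%N ->
  rank t = (rank x).+2 /\ atoms x t = [set a; b].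
Proof.
move=> /rank_atom[xa _ ra] /rank_atom[xb _ rb] ab at' bt ty rt.
have xt := le_trans xa at'; have h := (bc xt (ltac:(rank_lia))).1.
have sub : [set a; b] \subset atoms x t.
  by apply/subsetP => c /set2P[]->; rewrite in_atoms ?xa ?at' ?ra ?xb ?bt ?rb eqxx.
have := subset_leq_card sub; rewrite h cards2 ab => le2.
split; first by rank_lia.
by apply/esym/eqP; rewrite eqEcard sub h cards2 ab; rank_lia.
Qed.

(** Both bounds have [a] and [b] as their atoms, and [adjacent_bound] places them in one
    boolean-like interval, where atoms determine elements. *)
Lemma adjacent_unique a b t1 t2 : a \in atoms x y -> b \in atoms x y -> a != b ->
  a <= t1 -> b <= t1 -> t1 <= y -> (rank t1 <= rank x + 2)%N ->
  a <= t2 -> b <= t2 -> t2 <= y -> (rank t2 <= rank x + 2)%N -> t1 = t2.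
Proof.
move=> aA bA ab at1 bt1 t1y r1 at2 bt2 t2y r2.
have [_ h1] := adjacent_rank2 aA bA ab at1 bt1 t1y r1.
have [_ h2] := adjacent_rank2 aA bA ab at2 bt2 t2y r2.
have [w [t1w t2w wy rw]] := adjacent_bound aA at1 at2 t1y t2y r1 r2.
have [xa _ _] := rank_atom aA.
have xt1 := le_trans xa at1; have xt2 := le_trans xa at2.
by apply/le_anti/andP; split; apply: (le_of_atoms gr bc rw) => //; rewrite h1 h2.
Qed.

(** The interval [[a, y]] has [m] atoms. Each lies over exactly one atom other than [a], and by
    [adjacent_unique] no two lie over the same one. *)
Lemma card_adjacent a : a \in atoms x y ->
  #|[set b in atoms x y | adjacent a b]| = m.+1.
Proof.
move=> aA; have [xa ay ra] := rank_atom aA.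
rewrite (cardsD1 a) inE aA adjacent_refl //=.
set N := _ :\ a; congr S.
transitivity (\sum_(b in N) \sum_(t in atoms a y) ((b <= t)%O : nat))%N.
  rewrite -sum1_card; apply: eq_bigr => b /setD1P[nba /setIdP[bA ab]].
  case/existsP: ab => t /and4P[at' bt ty rt].
  rewrite eq_sym in nba.
  have [rt2 _] := adjacent_rank2 aA bA nba at' bt ty rt.
  rewrite (bigD1 t) /=; last by rewrite in_atoms at' ty ra rt2 eqxx.
  rewrite bt big1 ?addn0 // => t2 /andP[].
  rewrite in_atoms => /and3P[at2 t2y /eqP rt2'] nt.
  apply/eqP; rewrite eqb0; apply: contra nt => bt2; apply/eqP.
  by apply: (adjacent_unique aA bA nba) => //; rewrite ?rt2' ?ra; rank_lia.
rewrite exchange_big /=.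
have <- : #|atoms a y| = m by rewrite (bc ay (ltac:(rank_lia))).1; rank_lia.
rewrite -sum1_card; apply: eq_bigr => t; rewrite in_atoms => /and3P[at' ty /eqP rt].
have xt := le_trans xa at'.
have h := (bc xt (ltac:(rank_lia))).1.
have at2 : a \in atoms x t by rewrite in_atoms xa at' ra eqxx.
have := cardsD1 a (atoms x t); rewrite at2 h rt ra => h1.
suff -> : (\sum_(b in N) ((b <= t)%O : nat) = #|atoms x t :\ a|)%N by rank_lia.
rewrite -sum1_card big_mkcond [RHS]big_mkcond /=; apply: eq_bigr => b _.
rewrite !in_setD1 inE !in_atoms.
have [bt|] := boolP (b <= t); last by rewrite /= !andbF if_same.
rewrite (le_trans bt ty) /=; congr (if _ then _ else _).
rewrite -!andbA; congr (_ && _); rewrite andbA andbC.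
apply/andb_idl => _; apply/existsP; exists t; rewrite at' bt ty rt ra /=; rank_lia.
Qed.

Definition atom_classes : {set {set P}} := equivalence_partition adjacent (atoms x y).

Lemma atom_classesP : partition atom_classes (atoms x y).
Proof. exact: equivalence_partitionP adjacent_equiv. Qed.

Lemma card_atom_class K : K \in atom_classes -> #|K| = m.+1.
Proof. by case/imsetP=> a aA ->; apply: card_adjacent. Qed.

Lemma card_atom_classes : #|atoms x y| = (#|atom_classes| * m.+1)%N.
Proof. exact: card_uniform_partition card_atom_class atom_classesP. Qed.

Lemma pblock_atom_classes a b : a \in atoms x y -> b \in atoms x y ->
  (b \in pblock atom_classes a) = adjacent a b.
Proof. by move=> aA bA; apply: (pblock_equivalence_partition adjacent_equiv). Qed.

Lemma atom_class_adjacent K a b :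
  K \in atom_classes -> a \in K -> b \in K -> adjacent a b.
Proof.
move=> KC aK bK; have sK := subsetP (partitionS atom_classesP KC).
rewrite -pblock_atom_classes ?sK // (def_pblock _ KC aK) //.
by case/and3P: atom_classesP.
Qed.

(** The base moves from [x] to an atom [a] below [z], since [[a, y]] is boolean-like while [[x, y]]
    need not be. An atom [t] of [[a, z]] lies over a second atom [b], and by [adjacent_unique] it
    equals the bound of [a] and [b] found below [w]. *)
Lemma le_of_atoms_global z w : x < z -> z <= y -> w <= y ->
  (rank z - rank x <= m)%N -> (rank w - rank x <= m)%N ->
  atoms x z \subset atoms x w -> z <= w.
Proof.
move=> xz zy wy rz rw sub; have /card_gt0P[a az] := atoms_gt0 gr xz.
have aw := subsetP sub a az.
have aA : a \in atoms x y := subsetP (atomsS _ zy) a az.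
have [xa ay ra] := rank_atom aA.
have {az} az' : a <= z by move: az; rewrite in_atoms => /and3P[].
have aw' : a <= w by move: aw; rewrite in_atoms => /and3P[].
have ley : (rank y - rank a <= m)%N by rank_lia.
apply: (le_of_atoms gr bc ley) => //; apply/subsetP => t.
rewrite !in_atoms => /and3P[at' tz /eqP rt]; rewrite at' rt eqxx andbT /=.
have xt := le_trans xa at'; have ht := (bc xt (ltac:(rank_lia))).1.
have : ~~ (atoms x t \subset [set a]).
  by apply/negP => /subset_leq_card; rewrite cards1 ht; rank_lia.
case/subsetPn=> b bt; rewrite inE eq_sym => nab.
have bz : b \in atoms x z := subsetP (atomsS _ tz) b bt.
have bA : b \in atoms x y := subsetP (atomsS _ zy) b bz.
have bt' : b <= t by move: bt; rewrite in_atoms => /and3P[].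
have [t' [at1 bt1 tw rt1]] := adjacent_witness rw aw (subsetP sub b bz).
have -> // : t = t'.
apply: (adjacent_unique aA bA nab) => //; rewrite ?(le_trans tz zy) ?(le_trans tw wy) //.
by rank_lia.
Qed.

(** For a fixed [a] in [S], the atoms of [[a, y]] correspond to the members of the class other than
    [a]; so [S] prescribes a set of atoms of the boolean-like [[a, y]]. *)
Lemma atom_class_subset K (S : {set P}) : K \in atom_classes -> S \subset K ->
  S != set0 -> S != K ->
  exists z, [/\ x <= z, z <= y, (rank z - rank x <= m)%N & atoms x z = S].
Proof.
move=> KC SK /set0Pn[a aS] nSK; have sK := subsetP (partitionS atom_classesP KC).
have aK := subsetP SK a aS; have aA := sK a aK; have [xa ay ra] := rank_atom aA.
pose T := [set t in atoms a y | [exists b in S, (b != a) && (b <= t)]].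
have ley : (rank y - rank a <= m)%N by rank_lia.
have [|z [az zy zT]] := atoms_surj gr bc (S := T) ay ley.
  by apply/subsetP => t /setIdP[].
(* The only atoms below such a [t] are [a] and [c], so [t] in [T] forces [c] into [S]. *)
have joinT c t : c \in K -> c != a -> a <= t -> c <= t -> t <= z ->
    (rank t <= rank x + 2)%N -> c \in S.
  move=> cK nca at' ct tz rt; have ty := le_trans tz zy.
  rewrite eq_sym in nca; have cA := sK c cK.
  have [rt2 ht] := adjacent_rank2 aA cA nca at' ct ty rt.
  have : t \in T by rewrite -zT in_atoms at' tz rt2 ra eqxx.
  case/setIdP=> _ /exists_inP[b bS /andP[nba bt]].
  have [xb _ rb] := rank_atom (sK b (subsetP SK b bS)).
  have : b \in atoms x t by rewrite in_atoms xb bt rb eqxx.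
  by rewrite ht !inE (negbTE nba) /= => /eqP <-.
(* With [z = y], every member of [K] would be joined to [a] below [z], giving [S = K]. *)
have zlt : z != y.
  apply: contraNneq nSK => zy'; rewrite eqEsubset SK; apply/subsetP => c cK.
  have [->//|nca] := eqVneq c a.
  have /existsP[t /and4P[at' ct ty rt]] := atom_class_adjacent KC aK cK.
  by apply: (joinT c t) => //; rewrite zy'.
have rz : (rank z < rank y)%N by apply: rank_lt => //; rewrite lt_neqAle zlt.
have rzm : (rank z - rank x <= m)%N by rank_lia.
exists z; split=> //; first exact: le_trans xa az.
have azA : a \in atoms x z by rewrite in_atoms xa az ra eqxx.
apply/setP => c; apply/idP/idP => [cz|cS].
  have [->//|nca] := eqVneq c a.
  have cA : c \in atoms x y := subsetP (atomsS _ zy) c cz.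
  have [t [at' ct tz rt]] := adjacent_witness rzm azA cz.
  apply: (joinT c t) => //; have adj := adjacent_below zy rzm azA cz.
  rewrite -pblock_atom_classes // (def_pblock _ KC aK) in adj => //.
  by case/and3P: atom_classesP.
have [->//|nca] := eqVneq c a.
have cK := subsetP SK c cS; have [xc _ rc] := rank_atom (sK c cK).
have /existsP[t /and4P[at' ct ty rt]] := atom_class_adjacent KC aK cK.
have nac : a != c by rewrite eq_sym.
have [rt2 _] := adjacent_rank2 aA (sK c cK) nac at' ct ty rt.
have tT : t \in atoms a z.
  rewrite zT inE in_atoms at' ty rt2 ra eqxx /=.
  by apply/exists_inP; exists c => //; rewrite nca.
by move: tT; rewrite !in_atoms => /and3P[_ tz _]; rewrite xc rc eqxx (le_trans ct tz).
Qed.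

End Adjacency.

(** * The Euler relation on level sizes *)

Section Euler.
Import GRing.Theory.
Local Open Scope ring_scope.
Context {d : Order.disp_t} {P : finTBPOrderType d}.
Implicit Types (x y z w : P).
Hypothesis gr : forall x y : P, (x <= y)%O -> graded_interval x y.
Hypothesis eu : forall x y : P, (x < y)%O ->
  #|[set z in interval x y | ~~ odd (rank z)]|
  = #|[set z in interval x y | odd (rank z)]|.

(** Equal even and odd counts mean that the signs [(-1) ^+ rank z] sum to zero; it remains to group
    by level and cancel [(-1) ^+ rank x]. *)
Lemma euler_sum x y m : (x < y)%O -> rank y = (rank x + m)%N ->
  \sum_(0 <= i < m.+1) (-1) ^+ i * (#|level x y i|)%:R = 0 :> int.
Proof.
move=> xy rxy.
have s0 : \sum_(z in interval x y) (-1) ^+ rank z = 0 :> int.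
  rewrite (bigID (fun z => odd (rank z))) /=.
  rewrite (eq_bigr (fun=> -1 : int)) => [|z /andP[_ o]]; last by rewrite -signr_odd o.
  rewrite [X in _ + X](eq_bigr (fun=> 1 : int)) => [|z /andP[_ o]]; last first.
    by rewrite -signr_odd (negbTE o).
  rewrite !sumr_const mulNrn addrC; apply/eqP; rewrite subr_eq0; apply/eqP.
  by congr (_ *+ _); have := eu xy; rewrite !cardsE.
rewrite big_mkord.
have s1 : \sum_(i < m.+1) (-1) ^+ rank x * ((-1) ^+ i * (#|level x y i|)%:R) = 0 :> int.
  rewrite -s0 (partition_big (fun z => inord (rank z - rank x) : 'I_m.+1) predT) //=.
  apply: eq_bigr => i _; rewrite mulrA -exprD mulr_natr -sumr_const.
  rewrite (eq_bigr (fun z => (-1) ^+ rank z)) => [|z]; last first.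
    by rewrite in_level => /and3P[_ _ /eqP ->].
  apply: eq_bigl => z; rewrite in_level in_interval -andbA.
  have [xz|//] := boolP (x <= z)%O; have [zy|//] := boolP (z <= y)%O => /=.
  have h1 := rank_le gr xz; have h2 := rank_le gr zy.
  rewrite -val_eqE /= inordK; last by rewrite ltnS leq_subLR -rxy.
  by rewrite -(eqn_add2l (rank x) (_ - _)) subnKC.
by move/eqP: s1; rewrite -mulr_sumr mulf_eq0 signr_eq0 => /eqP.
Qed.

Lemma alternating_binomials m : (0 < m)%N ->
  \sum_(0 <= i < m.+1) (-1) ^+ i * ('C(m, i))%:R = 0 :> int.
Proof.
move=> m0; have := exprDn (1 : int) (-1) m; rewrite addrN expr0n eqn0Ngt m0 /= => e.
rewrite big_mkord [RHS]e; apply: eq_bigr => i _.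
by rewrite expr1n mul1r mulr_natr.
Qed.

(** From ['C(m, 2)] times the Euler relation subtract the size of level 2 times the alternating
    binomial sum. The terms with [2 <= i <= m - 2] cancel, leaving the two lowest and the two
    highest levels. *)
Lemma euler_level2 x y m : (x < y)%O -> rank y = (rank x + m)%N ->
  ~~ odd m -> (4 <= m)%N ->
  (forall i, (2 <= i <= m - 2)%N ->
     (#|level x y i| * 'C(m, 2) = #|level x y 2| * 'C(m, i))%N) ->
  (2 * m + 4 * #|level x y 2| = (#|level x y 1| + #|level x y m.-1|) * m)%N.
Proof.
move=> xy rxy em m4 hl.
have := euler_sum xy rxy; set F := fun i => #|level x y i|.
rewrite -/F in hl *; move=> sF.
have F0 : F 0%N = 1%N by rewrite /F level0 ?cards1 ?ltW.
have Fm : F m = 1%N by rewrite /F -{1}(addKn (rank x) m) -rxy level_top ?cards1 // ltW.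
have sC := @alternating_binomials m (leq_trans (isT : 0 < 4)%N m4).
have s : \sum_(0 <= i < m.+1)
    (-1) ^+ i * ((F i)%:R * ('C(m, 2))%:R - (F 2)%:R * ('C(m, i))%:R) = 0 :> int.
  transitivity ((\sum_(0 <= i < m.+1) (-1) ^+ i * (F i)%:R) * ('C(m, 2))%:R
    - (F 2)%:R * (\sum_(0 <= i < m.+1) (-1) ^+ i * ('C(m, i))%:R) : int).
    rewrite mulr_suml mulr_sumr -sumrB; apply: eq_bigr => i _; ring.
  by rewrite sF sC mul0r mulr0 subr0.
have [k mk] : exists k, m = k.+4 by exists (m - 4)%N; lia.
move: s; rewrite mk big_nat_recr // big_nat_recr // big_nat_recl // big_nat_recl //=.
rewrite big_nat_cond big1 ?addr0 => [|i /andP[/andP[_ ik] _]]; last first.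
  by rewrite -!natrM -mk hl ?subrr ?mulr0 //; lia.
have ek : odd k.+2 = false by move: em; rewrite mk /= !negbK => /negbTE.
have -> : (-1) ^+ k.+4 = 1 :> int by rewrite -signr_odd -mk (negbTE em).
have -> : (-1) ^+ k.+3 = -1 :> int by rewrite exprS -signr_odd ek mulr1.
rewrite -mk Fm F0 expr0 expr1 !mul1r !mulN1r bin0 binn bin1.
have -> : 'C(m, k.+3) = m by rewrite mk binSn.
have c2 : ('C(m, 2) * 2 = m * m.-1)%N.
  by rewrite bin2 -[in RHS](odd_double_half (m * m.-1)) oddM (negbTE em) /= add0n muln2.
rewrite mk /= -mk in c2 *.
rewrite /F; move: (#|level x y 2|) (#|level x y 1|) (#|level x y k.+3|) => T p q.
move: ('C(m, 2)) c2 => c c2 e.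
have e1 : (c * 2 + 2 * m * T = 2 * T + (p + q) * c)%N.
  by apply/eqP; rewrite -eqz_nat; apply/eqP; move: e; rewrite -!natz; lia.
have e2 : (2 * (m * k.+3) + 4 * m * T = 4 * T + (p + q) * (m * k.+3))%N.
  by rewrite -c2; lia.
(* Here [k.+3] is [m - 1], a common factor once ['C(m, 2) * 2] has become [m * m.-1]. *)
apply/eqP; rewrite -(@eqn_pmul2r k.+3) //; apply/eqP.
by rewrite mk in e2 *; lia.
Qed.

End Euler.

(** If [l >= 2], then [p (m - 1) <= T] and [q (m - 1) <= 2 T], so the last relation times [m - 1]
    gives [2 m (m - 1) + 4 T (m - 1) <= 3 T m], impossible for [m >= 4]. The same holds for [k]. *)
Lemma even_level_solution m T p q k l : (4 <= m)%N -> (0 < k)%N -> (0 < l)%N ->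
  (p * (m.-1 * l) = T * 2)%N -> (q * (m.-1 * k) = T * 2)%N ->
  (2 * m + 4 * T = (p + q) * m)%N -> [/\ l = 1, k = 1, p = m & q = m]%N.
Proof.
(* From here on [m] denotes the predecessor of the original one. *)
case: m => [//|m] m4 k0 l0 /= hp hq h.
have hp1 : (p * m * l = T * 2)%N by rewrite -mulnA.
have hq1 : (q * m * k = T * 2)%N by rewrite -mulnA.
have hpq : ((p * m + q * m) * m.+1 = m * (2 * m.+1 + 4 * T))%N by rewrite h; ring.
have lp : (p * m <= T * 2)%N by rewrite -hp1 leq_pmulr.
have lq : (q * m <= T * 2)%N by rewrite -hq1 leq_pmulr.
have l1 : l = 1%N.
  case: l l0 hp1 {hp} => [//|[//|l]] _ hp1.
  have lp2 : (p * m <= T)%N by nia.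
  nia.
have k1 : k = 1%N.
  case: k k0 hq1 {hq} => [//|[//|k]] _ hq1.
  have lq2 : (q * m <= T)%N by nia.
  nia.
rewrite l1 muln1 in hp1; rewrite k1 muln1 in hq1.
have pq : p = q by apply/eqP; rewrite -(@eqn_pmul2r m) ?hp1 ?hq1 //; lia.
split=> //; nia.
Qed.

(** * Level sizes in Eulerian intervals *)

Section Counts.
Local Open Scope order_scope.
Context {d : Order.disp_t} {P : finTBPOrderType d}.
Implicit Types (x y z w : P).
Hypothesis gr : forall x y : P, x <= y -> graded_interval x y.
Hypothesis eu : forall x y : P, x < y ->
  #|[set z in interval x y | ~~ odd (rank z)]|
  = #|[set z in interval x y | odd (rank z)]|.

(** The two bounds make the intervals above level [i] and below level [i.+1] boolean-like, although
    [[x, y]] may be longer than [k]. *)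
Lemma boolean_level_ratio x y r k i : rank y = (rank x + r)%N -> boolean_counts (P := P) k ->
  (r - i <= k)%N -> (i < k)%N ->
  (#|level x y i| * (r - i) = #|level x y i.+1| * i.+1)%N.
Proof.
move=> rxy bc le1 le2; apply: level_ratio => z; rewrite in_level => /and3P[xz zy /eqP rz].
  by rewrite (bc _ _ zy (ltac:(rank_lia))).1; rank_lia.
by rewrite (bc _ _ xz (ltac:(rank_lia))).2; rank_lia.
Qed.

(** The ratios hold from level 1 up to level [r.-1], and ['C(r, 1) = 'C(r, r.-1)]. *)
Lemma card_atoms_coatoms x y r : rank y = (rank x + r)%N -> (2 <= r)%N ->
  boolean_counts (P := P) r.-1 -> #|atoms x y| = #|coatoms x y|.
Proof.
case: r => [//|r] rxy r2 bc.
rewrite -level1 -(level_coatoms rxy).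
have := @level_binomial d P x y 1 r r.+1 r2; rewrite bin1 binSn.
move=> h; apply/esym/eqP; rewrite -(@eqn_pmul2r r.+1) // h //.
by move=> i /andP[i1 ir]; apply: boolean_level_ratio bc _ _ => //; lia.
Qed.

Lemma even_interval x y m k l : x < y -> rank y = (rank x + m)%N ->
  ~~ odd m -> (4 <= m)%N -> boolean_counts (P := P) (m - 2) -> (0 < k)%N -> (0 < l)%N ->
  (forall z, z \in atoms x y -> #|atoms z y| = (m.-1 * l)%N) ->
  (forall w, w \in coatoms x y -> #|coatoms x w| = (m.-1 * k)%N) ->
  [/\ l = 1, k = 1, #|atoms x y| = m & #|coatoms x y| = m]%N.
Proof.
move=> xy rxy em m4 bc k0 l0 hl hk.
have e := euler_level2 gr eu xy rxy em m4.
have bin i : (2 <= i <= m - 2)%N ->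
     (#|level x y i| * 'C(m, 2) = #|level x y 2| * 'C(m, i))%N.
  move=> /andP[i2 im]; apply: level_binomial => // [j /andP[j2 ji]|]; last by lia.
  by apply: boolean_level_ratio bc _ _ => //; lia.
have {e} := e bin; have [r mr] : exists r, m = r.+3 by exists (m - 3)%N; lia.
have rxy' : rank y = (rank x + r.+2.+1)%N by rewrite rxy mr.
rewrite level1 {2}mr /= (level_coatoms rxy') => e.
apply: even_level_solution e => //.
  rewrite -level1; apply: level_ratio => [z|w]; first by rewrite level1; apply: hl.
  rewrite in_level => /and3P[xw wy /eqP rw].
  by rewrite (bc _ _ xw (ltac:(rank_lia))).2 rw addKn.
rewrite -(level_coatoms rxy').
(* Here [r.+1] is [m - 2], and ['C(m, 2) = 'C(m, m - 2)]. *)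
have -> : #|level x y 2| = #|level x y r.+1|.
  apply/esym/eqP; rewrite -(@eqn_pmul2r 'C(m, 2)) ?bin_gt0; last by lia.
  rewrite bin; last by lia.
  by rewrite mr -(@bin_sub r.+3 2) // !subSS subn0.
apply/esym; apply: level_ratio => [z|w]; last by rewrite (level_coatoms rxy'); apply: hk.
rewrite in_level => /and3P[xz zy /eqP rz].
by rewrite (bc _ _ zy (ltac:(rank_lia))).1 rz rxy'; rank_lia.
Qed.

Lemma boolean_counts2 : boolean_counts (P := P) 2.
Proof.
move=> x y xy; have := rank_interval_length gr xy.
set r := interval_length x y => rxy; rewrite rxy addKn => r2.
case: r rxy r2 => [|[|[|//]]] rxy _.
- rewrite addn0 in rxy; have <- : x = y by apply: rank_le_eq gr _ _ xy _; rewrite rxy.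
  rewrite atoms_diag // cards0; split=> //; apply/eqP; rewrite cards_eq0; apply/eqP.
  apply/setP => z; rewrite in_coatoms in_set0; apply/negP => /and3P[/(rank_le gr) h _ /eqP].
  by move=> e; rewrite -e ltnn in h.
- rewrite -level1 -(level_coatoms rxy) level0 // cards1.
  by rewrite -{1}(addKn (rank x) 1) -rxy level_top // cards1.
- rewrite -(level_coatoms rxy) -level1.
  have ltxy : x < y by apply: lt_rank => //; rewrite rxy; lia.
  have := euler_sum gr eu ltxy rxy; rewrite !big_nat_recr //= big_geq //.
  rewrite level0 // -{2}(addKn (rank x) 2) -rxy level_top // !cards1.
  by lia.
Qed.

End Counts.

(** * Boolean-like intervals from the factorial functions *)

Section Sheffer.
Local Open Scope order_scope.
Context {d : Order.disp_t} {P : finTBPOrderType d}.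
Implicit Types (x y z w : P).
Variables (B D : nat -> nat).
Hypothesis hE : eulerian P.
Hypothesis hS : sheffer P B D.

Let gr : forall x y : P, x <= y -> graded_interval x y.
Proof. by case: hS. Qed.

Let eu : forall x y : P, x < y ->
  #|[set z in interval x y | ~~ odd (rank z)]|
  = #|[set z in interval x y | odd (rank z)]|.
Proof. by case: hE. Qed.

Lemma card_maximal_chains_atoms x y : x < y ->
  #|maximal_chains x y| = (\sum_(z in atoms x y) #|maximal_chains z y|)%N.
Proof.
by move=> xy; rewrite card_maximal_chains //; apply: eq_bigl => z; rewrite atomsE.
Qed.

(** An atom is never [\bot], so the chains above it are counted by [B], even when [x] is [\bot]. *)
Lemma maximal_chains_sheffer x y : x < y -> exists2 N, (0 < N)%N &
  N = B (rank y - rank x).-1 /\ #|maximal_chains x y| = (#|atoms x y| * N)%N.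
Proof.
move=> xy; exists (B (rank y - rank x).-1).
  have /card_gt0P[z] := atoms_gt0 gr xy.
  rewrite in_atoms => /and3P[xz zy /eqP rz].
  have z0 : z != \bot by apply/eqP => z0; move: rz; rewrite z0 (rank_bot gr).
  case: hS => _ _ /(_ z y z0 zy); rewrite interval_length_rank // rz subnS => <-.
  by have [C mC] := maximal_chains_exists z y; apply/card_gt0P; exists C.
split=> //; rewrite card_maximal_chains_atoms // -sum_nat_const; apply: eq_bigr => z.
rewrite in_atoms => /and3P[xz zy /eqP rz].
have z0 : z != \bot by apply/eqP => z0; move: rz; rewrite z0 (rank_bot gr).
by case: hS => _ _ /(_ z y z0 zy) ->; rewrite interval_length_rank // rz subnS.
Qed.

(** Equal numbers of maximal chains are divided by the common factor of [maximal_chains_sheffer]. *)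
Lemma atoms_uniform x y x' y' : x < y -> x' < y' ->
  (x == \bot) = (x' == \bot) -> (rank y - rank x = rank y' - rank x')%N ->
  #|atoms x y| = #|atoms x' y'|.
Proof.
move=> xy xy' ebot erank.
have [N N0 [NE h]] := maximal_chains_sheffer xy.
have [N' N0' [NE' h']] := maximal_chains_sheffer xy'.
rewrite erank -NE' in NE; rewrite {}NE in h.
apply/eqP; rewrite -(@eqn_pmul2r N') // -h -h'; apply/eqP.
case: hS => _ hD hB; have [x0|nx0] := eqVneq x \bot.
  have /eqP x0' : x' == \bot by rewrite -ebot x0.
  rewrite x0 x0' !hD !interval_length_rank ?le0x //.
  by move: erank; rewrite x0 x0' => ->.
have nx0' : x' != \bot by rewrite -ebot.
by rewrite !hB ?ltW // !interval_length_rank ?ltW // erank.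
Qed.

Lemma card_maximal_chains_length2 x y : x <= y -> rank y = (rank x).+2 ->
  #|maximal_chains x y| = 2.
Proof.
move=> xy rxy; have lt : x < y by apply: lt_rank; rewrite ?rxy.
have bc := boolean_counts2 gr eu.
have axy : #|atoms x y| = 2 by rewrite (bc _ _ xy (ltac:(rank_lia))).1; rank_lia.
rewrite card_maximal_chains_atoms // (eq_bigr (fun=> 1%N)) ?sum1_card // => z.
rewrite in_atoms => /and3P[xz zy /eqP rz].
have zlt : z < y by apply: lt_rank; rewrite ?rxy ?rz.
have azy : #|atoms z y| = 1%N by rewrite (bc _ _ zy (ltac:(rank_lia))).1; rank_lia.
rewrite card_maximal_chains_atoms // (eq_bigr (fun=> 1%N)) ?sum1_card // => t.
rewrite in_atoms => /and3P[zt ty /eqP rt].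
have -> : t = y by apply: rank_le_eq => //; rewrite rt rz rxy.
by rewrite maximal_chains_diag cards1.
Qed.

(** In length 3 there are six maximal chains, two above each atom, hence three atoms. *)
Lemma boolean_counts3 : B 3 = 6 -> D 3 = 6 -> boolean_counts (P := P) 3.
Proof.
move=> hB hD x y xy; have bc2 := boolean_counts2 gr eu.
rewrite leq_eqVlt => /predU1P[r3|]; last exact: bc2.
have lt : x < y by apply: lt_rank => //; lia.
have c6 : #|maximal_chains x y| = 6.
  case: hS => _ h0 h1; have [x0|nx0] := eqVneq x \bot.
    by rewrite x0 h0 interval_length_rank ?le0x // -x0 r3 hD.
  by rewrite h1 // interval_length_rank // r3 hB.
have : #|maximal_chains x y| = (#|atoms x y| * 2)%N.
  rewrite card_maximal_chains_atoms // -sum_nat_const; apply: eq_bigr => z.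
  rewrite in_atoms => /and3P[xz zy /eqP rz].
  by apply: card_maximal_chains_length2; rewrite // rz; rank_lia.
have rxy : rank y = (rank x + 3)%N by rank_lia.
rewrite c6 -(card_atoms_coatoms rxy) // r3; lia.
Qed.

(** Divisibility supplies the factors [k] and [l] of [even_interval], and [atoms_uniform] makes them
    independent of the atom or coatom. This settles length [m]; an interval of length [m - 1] is
    then extended to one of length [m]. *)
Lemma boolean_counts_even_step m : ~~ odd m -> (4 <= m)%N -> (m <= rank (\top : P))%N ->
  boolean_counts (P := P) (m - 2) ->
  (forall x y, x <= y -> rank y = (rank x + m.-1)%N -> (m.-1 %| #|atoms x y|)%N) ->
  boolean_counts (P := P) m.
Proof.
move=> em m4 mtop bc dv.
have eq1 x y : x <= y -> rank y = (rank x + m.-1)%N -> #|atoms x y| = #|coatoms x y|.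
  move=> xy rxy; apply: card_atoms_coatoms rxy _ _ => //; first by lia.
  by rewrite -subn1 -subn1 -subnDA.
have main x y : x <= y -> rank y = (rank x + m)%N ->
  [/\ #|atoms x y| = m, #|coatoms x y| = m,
      forall z, z \in atoms x y -> #|atoms z y| = m.-1
    & forall w, w \in coatoms x y -> #|coatoms x w| = m.-1].
  move=> xy rxy; have lt : x < y by apply: lt_rank => //; rank_lia.
  have atomP z : z \in atoms x y ->
      [/\ z <= y, z < y, (z == \bot) = false & rank y = (rank z + m.-1)%N].
    rewrite in_atoms => /and3P[xz zy /eqP rz]; split=> //.
    - by apply: lt_rank => //; rank_lia.
    - by apply/eqP => z0; move: rz; rewrite z0 (rank_bot gr).
    - by rank_lia.
  have coatomP w : w \in coatoms x y ->
      [/\ x <= w, x < w & rank w = (rank x + m.-1)%N].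
    rewrite in_coatoms => /and3P[xw wy /eqP rw]; split=> //.
    - by apply: lt_rank => //; rank_lia.
    - by rank_lia.
  have /card_gt0P[z0 z0A] := atoms_gt0 gr lt.
  have [w0 w0A] : exists w, w \in coatoms x y.
    have [|w] := @level_exists _ _ gr x y m.-1 xy; first by rank_lia.
    by rewrite level_coatoms ?prednK; [exists w | rank_lia | rank_lia].
  have [z0y lz0 nz0 rz0] := atomP _ z0A; have [xw0 lw0 rw0] := coatomP _ w0A.
  have /dvdnP[l hl] := dv _ _ z0y rz0; have /dvdnP[k hk] := dv _ _ xw0 rw0.
  have l0 : (0 < l)%N.
    by have := atoms_gt0 gr lz0; rewrite hl; case: (l).
  have k0 : (0 < k)%N.
    by have := atoms_gt0 gr lw0; rewrite hk; case: (k).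
  have hA z : z \in atoms x y -> #|atoms z y| = (m.-1 * l)%N.
    move=> /atomP[zy lz nz rz]; rewrite mulnC -hl; apply: atoms_uniform => //.
      by rewrite nz nz0.
    by rewrite rz0 addKn -rz0 rz addKn.
  have hC w : w \in coatoms x y -> #|coatoms x w| = (m.-1 * k)%N.
    move=> /coatomP[xw lw rw]; rewrite mulnC -hk -eq1 //; apply: atoms_uniform => //.
    by rewrite rw rw0.
  have [l1 k1 -> ->] := even_interval gr eu lt rxy em m4 bc k0 l0 hA hC.
  by split=> // [z /hA|w /hC] ->; rewrite ?l1 ?k1 muln1.
move=> x y xy le.
have [le2|gt2] := leqP (rank y - rank x) (m - 2); first exact: bc.
have lexy := rank_le gr xy.
have [rm|nrm] := eqVneq (rank y - rank x)%N m.
  have [|-> -> _ _] := main x y xy; first by rank_lia.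
  by rewrite rm.
have rm1 : rank y = (rank x + m.-1)%N.
  move/eqP: nrm => nrm; rank_lia.
rewrite -eq1 // rm1 addKn; suff : #|atoms x y| = m.-1 by [].
(* An interval starting at [\bot] is extended upwards, where [m <= rank \top] leaves room; any other
   is extended downwards. *)
have [x0|nx0] := eqVneq x \bot.
  have rx0 : rank x = 0%N by rewrite x0 (rank_bot gr).
  have lty : y < \top by apply: lt_rank; rewrite ?lex1 //; rank_lia.
  have [y' yy' _] := covers_exists lty; have ry' := rank_covers gr yy'.
  have leyy' : y <= y' by case/andP: yy' => /ltW.
  have [|_ _ _ h] := main x y' (le_trans xy leyy'); first by rank_lia.
  by rewrite eq1 // h // in_coatoms xy leyy' ry' eqxx.
have rx : (0 < rank x)%N by rewrite -(rank_bot gr) rank_lt // lt0x.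
have [|x'] := @level_exists _ _ gr \bot x (rank x).-1 (le0x x).
  by rewrite (rank_bot gr); rank_lia.
rewrite in_level (rank_bot gr) add0n => /and3P[_ x'x /eqP rx'].
have [|_ _ h _] := main x' y (le_trans x'x xy); first by rank_lia.
by apply: h; rewrite in_atoms x'x xy rx' prednK ?eqxx.
Qed.

(** Induction in steps of two. For [m = 4] the odd length is 3, where the atoms are counted by
    [boolean_counts3]; from [m = 6] on, divisibility comes from the adjacency classes of size
    [m - 1]. *)
Lemma boolean_counts_even m : B 3 = 6 -> D 3 = 6 ->
  ~~ odd m -> (4 <= m)%N -> (m <= rank (\top : P))%N -> boolean_counts (P := P) m.
Proof.
move=> hB hD; have bc3 := boolean_counts3 hB hD.
have [k] := ubnP m; elim: k m => // k IH m mk em m4 mtop.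
have [m4'|m5] := eqVneq m 4.
  apply: boolean_counts_even_step => //.
    by rewrite m4'; apply: boolean_countsW bc3.
  move=> x y xy; rewrite m4' /= => rxy.
  by rewrite (bc3 _ _ xy _).1 rxy addKn // dvdnn.
have m6 : (6 <= m)%N by move/eqP: m5 => m5; case: m em m4 m5 {mk mtop} => [|[|[|[|[|[|]]]]]].
have bc : boolean_counts (P := P) (m - 2).
  apply: IH; [lia | | lia | lia].
  by rewrite oddB ?(negbTE em) //; lia.
apply: boolean_counts_even_step => // x y xy rxy.
have [j mj] : exists j, m = j.+2 by exists (m - 2)%N; lia.
rewrite mj /= in rxy *; rewrite mj subSS subSS subn0 in bc.
rewrite (card_atom_classes gr _ rxy bc) ?dvdn_mull //; lia.
Qed.

End Sheffer.

(** * Isomorphisms with boolean lattices and their glued copies *)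

Section Isomorphisms.
Local Open Scope order_scope.

Lemma poset_iso_embedding d1 d2 (P : porderType d1) (Q : porderType d2) (f : P -> Q) :
  {mono f : x y / x <= y} -> (forall q, exists p, f p = q) -> poset_iso P Q.
Proof.
move=> fm fs; have fe q : exists p, f p == q by have [p <-] := fs q; exists p.
exists f; split=> //; exists (fun q => xchoose (fe q)) => [p|q].
  have /eqP e := xchooseP (fe (f p)).
  by apply: le_anti; rewrite -!fm e lexx.
exact/eqP/(xchooseP (fe q)).
Qed.

Lemma boxplus1_iso d1 d2 (P : porderType d1) (Q : tbPOrderType d2) :
  poset_iso P Q -> poset_iso P (boxplus 1 Q).
Proof.
case=> f [[g fK gK] fm].
apply: (@poset_iso_embedding _ _ _ _ (fun p => boxplus_pi (ord0, f p) : boxplus 1 Q)).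
  by move=> p q; rewrite boxplus_pi_le eqxx andbT fm.
move=> u; have [[i q] <-] := boxplus_pi_surj u; exists (g q).
by rewrite gK (ord1 i).
Qed.

(** When [#|K| = n.+1] and [a] is in [K], the index is in range and the default of [inord] does not
    occur. *)
Definition label (T : finType) n (K : {set T}) (a : T) : 'I_n.+1 :=
  inord (index a (enum K)).

Lemma label_inj (T : finType) n (K : {set T}) : #|K| = n.+1 ->
  {in K &, injective (label n K)}.
Proof.
move=> cK a b aK bK /(congr1 val) /=.
have lt c : c \in K -> (index c (enum K) < n.+1)%N.
  by move=> cK'; rewrite -cK cardE index_mem mem_enum.
rewrite !inordK ?lt // => e; rewrite -(@nth_index _ a a (enum K)) ?mem_enum // e.
by rewrite nth_index // mem_enum.
Qed.

Lemma label_surj (T : finType) n (K : {set T}) : #|K| = n.+1 ->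
  forall i, exists2 a, a \in K & label n K a = i.
Proof.
move=> cK i; suff /imsetP[a aK ->] : i \in label n K @: K by exists a.
suff -> : label n K @: K = setT by rewrite inE.
by apply/eqP; rewrite eqEcard subsetT cardsT card_ord card_in_imset ?cK ?ltnSn //; apply: label_inj.
Qed.

Context {d : Order.disp_t} {P : finTBPOrderType d}.
Implicit Types (z w a b : P).
Hypothesis gr : forall x y : P, x <= y -> graded_interval x y.

(** An element is sent to the labels of its atoms; [le_of_atoms] makes this an embedding and
    [atoms_surj] makes it onto. *)
Lemma boolean_lattice_iso n : (0 < n)%N -> rank (\top : P) = n ->
  boolean_counts (P := P) n -> poset_iso P (boolean_lattice n).
Proof.
case: n => // n _ rtop bc; pose A := atoms (\bot : P) \top.
have rle : (rank (\top : P) - rank (\bot : P) <= n.+1)%N by rewrite rtop leq_subr.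
have cA : #|A| = n.+1 by rewrite (bc _ _ (le0x _) rle).1 rtop (rank_bot gr) subn0.
have linj := label_inj cA; have lsurj := label_surj cA.
have sA z : {subset atoms \bot z <= A} by apply/subsetP/atomsS/lex1.
pose f z : boolean_lattice n.+1 := label n A @: atoms \bot z.
apply: (@poset_iso_embedding _ _ _ _ f) => [z w|S].
  rewrite boolean_lattice_leE; apply/idP/idP => [sub|zw]; last exact/imsetS/atomsS.
  apply: (le_of_atoms gr bc rle); rewrite ?le0x ?lex1 //; apply/subsetP => a az.
  have /imsetP[b bw e] := subsetP sub _ (imset_f (label n A) az).
  by have -> // : a = b; apply: linj e; [apply: (sA z) | apply: (sA w)].
pose T := [set a in A | label n A a \in (S : {set 'I_n.+1})].
have [|z [_ _ zT]] := atoms_surj gr bc (S := T) (le0x \top) rle.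
  by apply/subsetP => a /setIdP[].
exists z; rewrite /f zT; apply/setP => i; apply/imsetP/idP => [[a /setIdP[_ aS] ->] //|iS].
by have [a aA e] := lsurj i; exists a; rewrite // inE aA e.
Qed.

(** An element other than [\bot] and [\top] has all its atoms in one class. It goes to the copy
    indexed by that class and there to the labels of its atoms; [le_of_atoms_global] gives the
    embedding and [atom_class_subset] surjectivity. *)
Lemma boxplus_boolean_iso m : (3 <= m)%N -> rank (\top : P) = m.+1 ->
  boolean_counts (P := P) m ->
  exists k, (1 <= k)%N /\ poset_iso P (boxplus k (boolean_lattice m.+1)).
Proof.
move=> m3 rtop bc.
have r0 := rank_bot gr.
have rxy : rank (\top : P) = (rank (\bot : P) + m.+1)%N by rewrite r0.
pose KK := atom_classes (\bot : P) \top.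
have KP : partition KK (atoms \bot \top) := atom_classesP gr m3 rxy bc.
have tK : trivIset KK by case/and3P: KP.
have cK K : K \in KK -> #|K| = m.+1 := @card_atom_class _ _ gr _ _ _ m3 rxy bc K.
have bt : (\bot : P) < \top by apply: lt_rank; rewrite ?le0x // rxy; lia.
have K0 : (0 < #|KK|)%N.
  have := atoms_gt0 gr bt.
  by rewrite (card_atom_classes gr m3 rxy bc) -/KK; case: #|KK|.
have [k kE] : exists k, #|KK| = k.+1 by exists #|KK|.-1; rewrite prednK.
exists k.+1; split=> //.
have sA z : {subset atoms \bot z <= atoms \bot \top} by apply/subsetP/atomsS/lex1.
have pK a : a \in atoms \bot \top -> pblock KK a \in KK.
  by move=> aA; apply: pblock_mem; rewrite (cover_partition KP).
have mK a : a \in atoms \bot \top -> a \in pblock KK a.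
  by move=> aA; rewrite mem_pblock (cover_partition KP).
have rm z : z != \top -> (rank z - rank (\bot : P) <= m)%N.
  move=> nz; have : (rank z < rank (\top : P))%N.
    by apply: rank_lt => //; rewrite lt_neqAle nz lex1.
  by rewrite rtop r0 subn0 ltnS.
have same z a b : z != \top -> a \in atoms \bot z -> b \in atoms \bot z ->
    pblock KK a = pblock KK b.
  move=> nz az bz; apply/esym/same_pblock => //.
  rewrite (pblock_atom_classes gr m3 rxy bc) ?(sA z) //.
  exact: (adjacent_below gr m3 rxy bc (lex1 z) (rm z nz)).
pose lab a := label m (pblock KK a) a.
(* The value is a default at [\bot] and an arbitrary class at [\top]; both elements are glued, so
   the copy recorded for them does not matter. *)
pose cls z := pblock KK (odflt \bot [pick a in atoms \bot z]).
have atom_ex z : z != \bot -> exists a, a \in atoms \bot z.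
  by move=> nz; apply/card_gt0P/atoms_gt0 => //; rewrite lt0x.
have clsE z a : z != \top -> a \in atoms \bot z -> cls z = pblock KK a.
  move=> nz az; rewrite /cls; case: pickP => [b bz|/(_ a)]; last by rewrite az.
  exact: (same z).
pose I z : {set 'I_m.+1} := lab @: atoms \bot z.
have I0 z : (I z == set0) = (z == \bot).
  have [->|nz] := eqVneq z \bot; first by rewrite /I atoms_diag // imset0 eqxx.
  have [a az] := atom_ex z nz; apply/negbTE/set0Pn; exists (lab a); exact: imset_f.
have IT z : (I z == setT) = (z == \top).
  have [->|nz] := eqVneq z \top.
    apply/eqP/setP => i; rewrite inE.
    have [a aA] := atom_ex \top (negbT (gt_eqF bt)).
    have [b bK <-] := label_surj (cK _ (pK a aA)) i.
    have bA : b \in atoms \bot \top.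
      exact: (subsetP (partitionS KP (pK a aA))).
    apply/imsetP; exists b => //; congr (label m _ b).
    by apply: esym; apply: (def_pblock tK (pK a aA)).
  (* An element other than [\top] has at most [m] atoms, too few for all [m.+1] labels. *)
  apply/negP => /eqP e; have := leq_imset_card lab (atoms \bot z).
  rewrite -/(I z) e cardsT card_ord (bc _ _ (le0x z) (rm z nz)).1.
  by have := rm z nz; lia.
pose f z : boxplus k.+1 (boolean_lattice m.+1) :=
  boxplus_pi (label k KK (cls z), I z : boolean_lattice m.+1).
have fle z w : (f z <= f w) =
    (I z \subset I w) && [|| label k KK (cls z) == label k KK (cls w),
                            z == \bot | w == \top].
  by rewrite boxplus_pi_le boolean_lattice_leE -I0 -IT.
apply: (@poset_iso_embedding _ _ _ _ f) => [z w|u].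
  rewrite fle; have [->|nz] := eqVneq z \bot.
    by rewrite orbT andbT le0x /I atoms_diag // imset0 sub0set.
  have [->|nw] := eqVneq w \top.
    by rewrite !orbT andbT lex1; move: (IT \top); rewrite eqxx => /eqP ->; rewrite subsetT.
  rewrite !orbF; have [a az] := atom_ex z nz.
  apply/andP/idP => [[sub /eqP e]|zw]; last first.
    split; first exact/imsetS/atomsS.
    have nzt : z != \top by apply: contraNneq nw => zt; rewrite -le1x -zt.
    have aw : a \in atoms \bot w := subsetP (atomsS _ zw) a az.
    by rewrite (clsE _ _ nzt az) (clsE _ _ nw aw).
  have nw0 : w != \bot.
    by rewrite -I0; apply: contraTneq sub => ->; rewrite subset0 I0.
  have nzt : z != \top.
    by rewrite -IT; apply: contraTneq sub => ->; rewrite subTset IT.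
  have [b bw] := atom_ex w nw0.
  have ecls : cls z = cls w.
    apply: (label_inj kE) e.
      by rewrite (clsE _ _ nzt az); apply/pK/(sA z).
    by rewrite (clsE _ _ nw bw); apply/pK/(sA w).
  apply: (le_of_atoms_global gr m3 rxy bc); rewrite ?lt0x ?lex1 ?rm //.
  apply/subsetP => c cz; have /imsetP[c' cw e'] := subsetP sub _ (imset_f lab cz).
  have cA := sA z c cz; have c'A := sA w c' cw.
  rewrite /lab -(clsE _ _ nzt cz) -(clsE _ _ nw cw) ecls in e'.
  suff -> : c = c' by [].
  apply: label_inj e'; first by rewrite (clsE _ _ nw cw); apply/cK/pK.
    by rewrite -ecls (clsE _ _ nzt cz) mK.
  by rewrite (clsE _ _ nw cw) mK.
have [[i S] <-] := boxplus_pi_surj u.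
have [->|nS0] := eqVneq S \bot.
  exists \bot; apply/eqP; rewrite boxplus_pi_eq /glued.
  by move: (I0 \bot); rewrite eqxx => /eqP ->; rewrite eqxx orbT.
have [->|nST] := eqVneq S \top.
  exists \top; apply/eqP; rewrite boxplus_pi_eq /glued.
  by move: (IT \top); rewrite eqxx => /eqP ->; rewrite eqxx !orbT.
have [K KK' Ki] := label_surj kE i.
(* [S] is pulled back along the labels of the class with index [i]. *)
pose T := [set a in K | label m K a \in (S : {set 'I_m.+1})].
have sKA : {subset K <= atoms \bot \top} by apply/subsetP/(partitionS KP).
have labK : {in K, forall a, lab a = label m K a}.
  by move=> a aK; rewrite /lab (def_pblock tK KK' aK).
have labT : label m K @: T = S.
  apply/setP => j; apply/imsetP/idP => [[a /setIdP[_ aS] ->] //|jS].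
  by have [a aK e] := label_surj (cK K KK') j; exists a; rewrite // inE aK e.
have [||||z [_ _ rz zT]] := atom_class_subset gr m3 rxy bc (K := K) (S := T) => //.
- by apply/subsetP => a /setIdP[].
- by apply: contraNneq nS0 => T0; rewrite -labT T0 imset0.
- apply: contraNneq nST => TK; rewrite -labT TK; apply/eqP/setP => j; rewrite inE.
  by apply/imsetP; have [a aK <-] := label_surj (cK K KK') j; exists a.
have Iz : I z = S.
  rewrite -labT /I zT; apply: eq_in_imset => a /setIdP[aK _]; exact: labK.
have nzt : z != \top by rewrite -IT Iz.
have nz0 : z != \bot by rewrite -I0 Iz.
have [a az] := atom_ex z nz0.
have aK : a \in K by move: az; rewrite zT => /setIdP[].
exists z; rewrite /f Iz (clsE _ _ nzt az) (def_pblock tK KK' aK).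
by rewrite Ki.
Qed.

End Isomorphisms.

(** * The two parities of the rank *)

Theorem theorem4p12 (d : Order.disp_t) (P : finTBPOrderType d)
    (n : nat) (B D : nat -> nat)
    (hn : 3 <= n)
    (hrank : poset_rank P = n)
    (hE : eulerian P)
    (hS : sheffer P B D)
    (hB : B 3 = 6)
    (hD : D 3 = 6) :
  (odd n -> exists k : nat,
     1 <= k /\ poset_iso P (boxplus k (boolean_lattice n))) /\
  (~~ odd n -> poset_iso P (boolean_lattice n)).
Proof.
have gr : forall x y : P, (x <= y)%O -> graded_interval x y by case: hS.
have rtop : rank (\top%O : P) = n := hrank.
split=> [on|en]; last first.
  have n4 : 4 <= n by case: n hn en {hrank rtop} => [|[|[|[|]]]].
  apply: boolean_lattice_iso => //; first by lia.
  by apply: (boolean_counts_even hE hS) => //; rewrite rtop.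
(* Rank 3 stands apart: adjacency asks for [3 <= m] with [n = m.+1], while [boolean_counts3] already
   covers the whole of [P] and gives [k = 1]. *)
have [n3|nn3] := eqVneq n 3.
  exists 1; split=> //; apply/boxplus1_iso/boolean_lattice_iso; rewrite ?n3 //.
    by rewrite rtop.
  exact: boolean_counts3 hE hS hB hD.
(* Now [n = m.+1] with [m] even and at least 4, so every proper interval is boolean-like. *)
case: n hn on nn3 rtop {hrank} => // m m3 om nm3 rtop.
have m4 : 4 <= m by case: m m3 om nm3 {rtop} => [|[|[|[|]]]].
apply: boxplus_boolean_iso => //; first exact: ltnW.
by apply: (boolean_counts_even hE hS) => //; rewrite rtop.
Qed.
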